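(* Let $\mathbb{K}$ be a field of characteristic zero, $L$ a Leibniz algebra over $\mathbb{K}$ with $\dim_{\mathbb{K}}\mathbb{H}<\infty$, where $\mathbb{H}=HL^2(L;L)$, and let $\eta_1$ be the infinitesimal deformation of $L$ with base $C_1=\mathbb{K}\oplus\mathbb{H}'$ described in the context. For any infinitesimal deformation $\lambda$ of $L$ with a finite-dimensional base $A$ there exists a unique homomorphism $\phi:C_1=\mathbb{K}\oplus\mathbb{H}'\to A$ such that $\lambda$ is equivalent to the push-out $\phi_*\eta_1$.
   Context: A Leibniz algebra over a commutative ring $R$ is an $R$-module with an $R$-bilinear bracket satisfying $[x,[y,z]]=[[x,y],z]-[[x,z],y]$. For a Leibniz algebra $L$ over $\mathbb{K}$, $CL^n(L;L)=\mathrm{Hom}_{\mathbb{K}}(L^{\otimes n},L)$ with differential $$\delta f(x_1,\dots,x_{n+1})=[x_1,f(x_2,\dots,x_{n+1})]+\sum_{i=2}^{n+1}(-1)^i[f(x_1,\dots,\hat x_i,\dots,x_{n+1}),x_i]+\sum_{1\le i<j\le n+1}(-1)^{j+1}f(x_1,\dots,x_{i-1},[x_i,x_j],x_{i+1},\dots,\hat x_j,\dots,x_{n+1}),$$ and $HL^n(L;L)$ is its cohomology. A prime denotes the $\mathbb{K}$-linear dual. Bases are commutative unital $\mathbb{K}$-algebras $A$ with an augmentation $\varepsilon:A\to\mathbb{K}$ (unital algebra homomorphism), $\mathfrak{M}=\ker\varepsilon$. Homomorphisms of bases are unital $\mathbb{K}$-algebra homomorphisms compatible with augmentations. A deformation $\lambda$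 of $L$ with base $A$ is an $A$-Leibniz algebra structure $[,]_\lambda$ on $A\otimes_{\mathbb{K}}L$ such that $\varepsilon\otimes\mathrm{id}:A\otimes L\to\mathbb{K}\otimes L=L$ is a homomorphism. It is infinitesimal if $A$ is local (with maximal ideal $\mathfrak{M}$) and $\mathfrak{M}^2=0$. Two deformations $\lambda_1,\lambda_2$ with base $A$ are equivalent if there is an isomorphism of $A$-Leibniz algebras $\rho:(A\otimes L,[,]_{\lambda_1})\to(A\otimes L,[,]_{\lambda_2})$ with $(\varepsilon\otimes\mathrm{id})\circ\rho=\varepsilon\otimes\mathrm{id}$. For a homomorphism $\phi:A\to A'$ of bases, the push-out $\phi_*\lambda$ is the deformation with base $A'$ determined by $[1\otimes l_1,1\otimes l_2]_{\phi_*\lambda}=(\phi\otimes\mathrm{id})([1\otimes l_1,1\otimes l_2]_\lambda)$. $C_1=\mathbb{K}\oplus\mathbb{H}'$ has multiplication $(k_1,h_1)(k_2,h_2)=(k_1k_2,k_1h_2+k_2h_1)$ and augmentation the projection to $\mathbb{K}$. Fix a linear map $\mu:\mathbb{H}\to CL^2(L;L)$ sending each cohomology class to a cocycle representing it. With a basis $\{h_i\}_{1\le i\le n}$ of $\mathbb{H}$ and dual basis $\{g_i\}$ of $\mathbb{H}'$, $\eta_1$ is the deformation with base $C_1$ given by $[1\otimes l_1,1\otimes l_2]_{\eta_1}=1\otimes[l_1,l_2]+\sum_{i=1}^n g_i\otimes\mu(h_i)(l_1,l_2)$. *)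

(* Defs.v *)
From HB Require Import structures.
From mathcomp Require Import freeg.
From mathcomp Require Import all_boot all_algebra.
From mathcomp Require Import boolp functions.
From mathcomp Require Import ring.

Set Implicit Arguments.
Unset Strict Implicit.
Unset Printing Implicit Defensive.

Import GRing.Theory.
Import Quotient.

Local Open Scope ring_scope.
Local Open Scope quotient_scope.

Section Generated.
Variables (K : nzRingType) (V : lmodType K).

Definition is_submod (S : V -> Prop) : Prop :=
  S 0 /\ forall (a : K) u v, S u -> S v -> S (a *: u + v).

Definition generated (X : V -> Prop) : {pred V} := fun v =>
  `[< forall S, is_submod S -> (forall x, X x -> S x) -> S v >].

Fact generated_submod_closed X : submod_closed (generated X).
Proof.
split; first by apply/asboolP => S [].
move=> a u v /asboolP hu /asboolP hv; apply/asboolP => S hS hX.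
by apply: hS.2; [apply: hu | apply: hv].
Qed.

HB.instance Definition _ X :=
  GRing.isSubmodClosed.Build K V (generated X) (generated_submod_closed X).

End Generated.

Section QuotientModule.
Variables (K : nzRingType) (V : lmodType K) (S : submodClosed V).

(* [submodClosed] does not record closure under opposites, which the quotient
   of the underlying additive group requires. *)
Definition submod_group : {pred V} := fun v => v \in S.

Fact submod_group_closed : zmod_closed submod_group.
Proof.
split=> [|u v]; rewrite /in_mem /= /submod_group; first exact: rpred0.
by move=> uS vS; rewrite -scaleN1r rpredD // rpredZ.
Qed.

HB.instance Definition _ :=
  GRing.isZmodClosed.Build V submod_group submod_group_closed.

Definition quotmod : Type := {quot submod_group}.

HB.instance Definition _ := GRing.Zmodule.on quotmod.

Definition quot_class (v : V) : quotmod := \pi_({quot submod_group}) v.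

Definition quot_scale (a : K) (x : quotmod) : quotmod :=
  quot_class (a *: repr (x : {quot submod_group})).

Lemma quot_classE u v : (quot_class u = quot_class v) <-> u - v \in S.
Proof. rewrite -[u - v \in S]/(u - v \in submod_group) idealrBE.
by split=> [h|/eqP//]; apply/eqP. Qed.

Lemma quot_class_repr (x : quotmod) : quot_class (repr (x : {quot submod_group})) = x.
Proof. exact: reprK. Qed.

Lemma quot_class_zmod : zmod_morphism quot_class.
Proof. by move=> u v; exact: (raddfB (\pi_({quot submod_group}))). Qed.

Lemma quot_class_scale a v : quot_class (a *: v) = quot_scale a (quot_class v).
Proof.
apply/quot_classE; rewrite -scalerBr rpredZ //.
by apply/quot_classE; rewrite quot_class_repr.
Qed.

HB.instance Definition _ :=
  GRing.isZmodMorphism.Build V quotmod quot_class quot_class_zmod.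

Fact quot_scalerA a b x : quot_scale a (quot_scale b x) = quot_scale (a * b) x.
Proof.
by rewrite -[x]quot_class_repr -!quot_class_scale scalerA.
Qed.
Fact quot_scale1r : left_id 1 quot_scale.
Proof.
by move=> x; rewrite -[x]quot_class_repr -!quot_class_scale scale1r.
Qed.
Fact quot_scalerDr : right_distributive quot_scale +%R.
Proof.
move=> a x y; rewrite -[x]quot_class_repr -[y]quot_class_repr.
by rewrite -raddfD -!quot_class_scale -raddfD scalerDr.
Qed.
Fact quot_scalerDl x : {morph quot_scale^~ x : a b / a + b}.
Proof.
move=> a b; rewrite -[x]quot_class_repr -!quot_class_scale -raddfD.
by rewrite scalerDl.
Qed.

HB.instance Definition _ := GRing.Zmodule_isLmodule.Build K quotmod
  quot_scalerA quot_scale1r quot_scalerDr quot_scalerDl.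

HB.instance Definition _ :=
  GRing.isScalable.Build K V quotmod *:%R quot_class quot_class_scale.

End QuotientModule.
Arguments quot_class {K V} S v.

Section Bilinear.
Variables (K : nzRingType) (V W U : lmodType K).

Definition is_bilinear (f : V -> W -> U) : Prop :=
  (forall w, linear (f^~ w)) /\ (forall v, linear (f v)).

Variable f : V -> W -> U.
Hypothesis fB : is_bilinear f.

Lemma bilinearDl w : {morph f^~ w : u v / u + v}.
Proof. by move=> u v; have := fB.1 w 1 u v; rewrite !scale1r. Qed.

Lemma bilinearDr v : {morph f v : w x / w + x}.
Proof. by move=> w x; have := fB.2 v 1 w x; rewrite !scale1r. Qed.

Lemma bilinear0l w : f 0 w = 0.
Proof. by apply: (addrI (f 0 w)); rewrite -bilinearDl !addr0. Qed.

Lemma bilinear0r v : f v 0 = 0.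
Proof. by apply: (addrI (f v 0)); rewrite -bilinearDr !addr0. Qed.

Lemma bilinearZl a v w : f (a *: v) w = a *: f v w.
Proof. by have := fB.1 w a v 0; rewrite !addr0 bilinear0l addr0. Qed.

Lemma bilinearZr a v w : f v (a *: w) = a *: f v w.
Proof. by have := fB.2 v a w 0; rewrite !addr0 bilinear0r addr0. Qed.

Lemma bilinear_suml (I : finType) (F : I -> V) w :
  f (\sum_i F i) w = \sum_i f (F i) w.
Proof. exact: (big_morph _ (bilinearDl w) (bilinear0l w)). Qed.

Lemma bilinear_sumr (I : finType) (F : I -> W) v :
  f v (\sum_i F i) = \sum_i f v (F i).
Proof. exact: (big_morph _ (bilinearDr v) (bilinear0r v)). Qed.

End Bilinear.

Section Dual.
Variables (K : comNzRingType) (V : lmodType K).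

Definition is_linear_form : {pred V -> K^o} := fun f => `[< linear f >].

Fact is_linear_form_submod_closed : submod_closed is_linear_form.
Proof.
split; first by apply/asboolP => a u v; rewrite /= scaler0 addr0.
move=> k f g /asboolP hf /asboolP hg; apply/asboolP => a u v.
rewrite !fctE /= hf hg !scalerDr -!addrA; congr (_ + _).
  by rewrite !scalerA mulrC.
by rewrite addrCA.
Qed.

HB.instance Definition _ := GRing.isSubmodClosed.Build K (V -> K^o)
  is_linear_form is_linear_form_submod_closed.

Record dual := Dual { dual_fun :> V -> K^o; dual_linear : is_linear_form dual_fun }.

HB.instance Definition _ := [isSub for dual_fun].
HB.instance Definition _ := [Choice of dual by <:].
HB.instance Definition _ := [SubChoice_isSubLmodule of dual by <:].

End Dual.

Section Bases.
Variables (K : comNzRingType) (V : lmodType K).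

Definition is_basis n (b : 'I_n -> V) : Prop :=
  forall v, exists! c : {ffun 'I_n -> K}, v = \sum_i c i *: b i.

Definition finite_dim : Prop := exists n (b : 'I_n -> V), is_basis b.

Definition is_dual_basis n (b : 'I_n -> V) (g : 'I_n -> dual V) : Prop :=
  forall i j, g i (b j) = (i == j)%:R.

End Bases.

Section Tensor.
Variables (K : comNzRingType) (V W : lmodType K).


Definition free_pair (v : V) (w : W) : {freeg (V * W)%type / K} := << (v, w) >>.

Inductive tensor_rel : {freeg (V * W)%type / K} -> Prop :=
| TensorRelL (a : K) u v w : tensor_rel
    (free_pair (a *: u + v) w - (a *: free_pair u w + free_pair v w))
| TensorRelR (a : K) v u w : tensor_rel
    (free_pair v (a *: u + w) - (a *: free_pair v u + free_pair v w)).

Definition tensor : Type := quotmod (generated tensor_rel).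

HB.instance Definition _ := GRing.Lmodule.on tensor.

Definition tens (v : V) (w : W) : tensor := quot_class _ (free_pair v w).

Lemma tens_linearl w : linear (tens^~ w).
Proof.
move=> a u v; rewrite /tens -[RHS]linearP; apply/quot_classE/asboolP => S _.
by apply; exact: TensorRelL.
Qed.

Lemma tens_linearr v : linear (tens v).
Proof.
move=> a u w; rewrite /tens -[RHS]linearP; apply/quot_classE/asboolP => S _.
by apply; exact: TensorRelR.
Qed.

Lemma tens_bilinear : is_bilinear tens.
Proof. by split; [exact: tens_linearl|exact: tens_linearr]. Qed.

Lemma tensor_ind (P : tensor -> Prop) :
    (forall v w, P (tens v w)) -> (forall s t, P s -> P t -> P (s + t)) ->
  forall t, P t.
Proof.
move=> Ptens PD t; rewrite -[t]quot_class_repr; move: (repr _) => D {t}.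
rewrite -[D]freeg_sumE raddf_sum /=.
apply: (big_ind P); [by rewrite -(bilinear0l tens_bilinear 0)|exact: PD|] => -[v w] _.
set k := coeff _ _; rewrite [X in P X](_ : _ = tens (k *: v) w) //.
rewrite (bilinearZl tens_bilinear) -linearZ /=; congr quot_class.
by apply/eqP/freeg_eqP => x; rewrite coeffZ !coeffU mul1r.
Qed.

End Tensor.

Section TensorLift.
Variables (K : comNzRingType) (V W U : lmodType K).

(* The linear map on the tensor product induced by [f], provided that [f] is
   bilinear; a junk value otherwise. *)
Definition tlift (f : V -> W -> U) (t : tensor V W) : U :=
  fglift (fun p => f p.1 p.2) (repr (t : {quot _})).

Fact fglift_linear (F : V * W -> U) : linear (fglift F).
Proof.
move=> a D E.
have liftD x y : fglift F (x + y) = fglift F x + fglift F y.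
  have liftB := @lift_is_additive _ _ _ F.
  have lift0 : fglift F 0 = 0 by rewrite -(subrr 0) liftB subrr.
  have liftN z : fglift F (- z) = - fglift F z.
    by rewrite -(add0r (- z)) liftB lift0 add0r.
  by rewrite -{1}(opprK y) liftB liftN opprK.
have lift0 : fglift F 0 = 0 by apply: (addrI (fglift F 0)); rewrite -liftD !addr0.
rewrite liftD; congr (_ + _).
rewrite -[in RHS](freeg_sumE D) -[a *: D]/(fgscale a D) /fgscale.
rewrite !(big_morph _ liftD lift0) scaler_sumr.
by apply: eq_bigr => x _; rewrite !liftU scalerA.
Qed.

Variable f : V -> W -> U.
Hypothesis fB : is_bilinear f.

Let fglift_quot D :
  tlift f (quot_class _ D) = fglift (fun p => f p.1 p.2) D.
Proof.
pose F := fglift (fun p : V * W => f p.1 p.2).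
have FL : linear F := fglift_linear _.
have FB : {morph F : x y / x - y} := @lift_is_additive _ _ _ _.
have FMp v w : F (free_pair v w) = f v w by rewrite [LHS]liftU scale1r.
have := quot_class_repr (quot_class (generated (@tensor_rel K V W)) D).
move/quot_classE/asboolP/(_ (fun D => F D = 0)) => h.
apply/eqP; rewrite -subr_eq0 -[fglift _ _]/(F D) -[tlift _ _]/(F _) -FB.
have F0 : F 0 = 0 by rewrite -(subrr 0) FB subrr.
apply/eqP; apply: h => [|x].
  by split=> // a u v hu hv; rewrite FL hu hv scaler0 addr0.
case=> [a u v w|a v u w]; rewrite FB FL !FMp.
  by rewrite fB.1 subrr.
by rewrite fB.2 subrr.
Qed.

Lemma tliftE v w : tlift f (tens v w) = f v w.
Proof. by rewrite fglift_quot liftU scale1r. Qed.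

Lemma tlift_linear : linear (tlift f).
Proof.
move=> a s t; rewrite -[s]quot_class_repr -[t]quot_class_repr -linearP.
by rewrite !fglift_quot fglift_linear.
Qed.

End TensorLift.

Definition is_leibniz (R : comNzRingType) (V : lmodType R)
    (br : V -> V -> V) : Prop :=
  is_bilinear br /\
  forall x y z, br x (br y z) = br (br x y) z - br (br x z) y.

Record leibniz_alg (R : comNzRingType) := LeibnizAlg {
  leibniz_sort :> lmodType R;
  bracket : leibniz_sort -> leibniz_sort -> leibniz_sort;
  bracket_leibniz : is_leibniz bracket }.

Section Cohomology.
Variables (K : comNzRingType) (L : leibniz_alg K).

Local Notation "[[ x , y ]]" := (bracket x y).

Definition upd n (x : 'I_n -> L) (k : 'I_n) (u : L) : 'I_n -> L :=
  fun j => if j == k then u else x j.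

Definition is_multilinear n : {pred ('I_n -> L) -> L} := fun f =>
  `[< forall x k, linear (fun u => f (upd x k u)) >].

Fact is_multilinear_submod_closed n : submod_closed (@is_multilinear n).
Proof.
split; first by apply/asboolP => x k a u v; rewrite /= scaler0 addr0.
move=> c f g /asboolP hf /asboolP hg; apply/asboolP => x k a u v.
rewrite !fctE /= hf hg !scalerDr -!addrA; congr (_ + _).
  by rewrite !scalerA mulrC.
by rewrite addrCA.
Qed.

HB.instance Definition _ n := GRing.isSubmodClosed.Build K (('I_n -> L) -> L)
  (@is_multilinear n) (@is_multilinear_submod_closed n).

(* CL n is Hom(L^{(x) n}, L), as multilinear maps in n arguments. *)
Record CL n := Cochain {
  cochain_fun :> ('I_n -> L) -> L;
  cochain_multilinear : cochain_fun \in @is_multilinear n }.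

HB.instance Definition _ n := [isSub for @cochain_fun n].
HB.instance Definition _ n := [Choice of CL n by <:].
HB.instance Definition _ n := [SubChoice_isSubLmodule of CL n by <:].

(* Arguments are numbered from 0, whence the shift by one in the exponents of
   the signs. [x \o lift i] omits x_i. *)
Definition delta n (f : ('I_n -> L) -> L) (x : 'I_n.+1 -> L) : L :=
  [[x ord0, f (x \o lift ord0)]]
  + \sum_(i < n.+1 | (0 < i)%N) (-1) ^+ i.+1 *: [[f (x \o lift i), x i]]
  + \sum_(i < n.+1) \sum_(j < n.+1 | (i < j)%N)
      (-1) ^+ j *: f (upd x i [[x i, x j]] \o lift j).

Lemma bracket_linearl z : linear (fun x : L => [[x, z]]).
Proof. exact: (bracket_leibniz L).1.1. Qed.

Lemma bracket_linearr x : linear (fun z : L => [[x, z]]).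
Proof. exact: (bracket_leibniz L).1.2. Qed.

Definition is_cocycle n : {pred CL n} := fun f =>
  `[< forall x, delta f x = 0 >].

Fact delta_linear n : linear (@delta n).
Proof.
move=> a f g; apply/funext => x; rewrite /delta !fctE bracket_linearr.
rewrite [X in _ + X + _ = _](_ : _ =
    a *: (\sum_(i < n.+1 | (0 < i)%N)
            (-1) ^+ i.+1 *: [[f (x \o lift i), x i]])
    + \sum_(i < n.+1 | (0 < i)%N)
            (-1) ^+ i.+1 *: [[g (x \o lift i), x i]]); last first.
  rewrite scaler_sumr -big_split; apply: eq_bigr => i _ /=.
  by rewrite bracket_linearl scalerDr !scalerA mulrC.
rewrite [X in _ + X = _](_ : _ =
    a *: (\sum_(i < n.+1) \sum_(j < n.+1 | (i < j)%N)
            (-1) ^+ j *: f (upd x i [[x i, x j]] \o lift j))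
    + \sum_(i < n.+1) \sum_(j < n.+1 | (i < j)%N)
            (-1) ^+ j *: g (upd x i [[x i, x j]] \o lift j)); last first.
  rewrite scaler_sumr -big_split; apply: eq_bigr => i _ /=.
  rewrite scaler_sumr -big_split; apply: eq_bigr => j _ /=.
  by rewrite scalerDr !scalerA mulrC.
by rewrite !scalerDr [RHS]addrACA; congr (_ + _); rewrite [RHS]addrACA.
Qed.

Fact delta0 n (x : 'I_n.+1 -> L) : delta 0 x = 0.
Proof.
have := delta_linear 1 (0 : ('I_n -> L) -> L) 0.
rewrite !scale1r addr0 => /(congr1 (@^~ x)); rewrite fctE.
by rewrite -[LHS]addr0 => /addrI.
Qed.

Fact is_cocycle_submod_closed n : submod_closed (@is_cocycle n).
Proof.
split.
  by apply/asboolP => x; rewrite [LHS]delta0.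
move=> a f g /asboolP hf /asboolP hg; apply/asboolP => x.
have /(congr1 (@^~ x)) := delta_linear a (f : _ -> _) (g : _ -> _).
by rewrite !fctE hf hg scaler0 addr0.
Qed.

HB.instance Definition _ n := GRing.isSubmodClosed.Build K (CL n)
  (@is_cocycle n) (@is_cocycle_submod_closed n).

Record ZL n := Cocycle {
  cocycle_cochain :> CL n;
  cocycle_closed : cocycle_cochain \in @is_cocycle n }.

HB.instance Definition _ n := [isSub for @cocycle_cochain n].
HB.instance Definition _ n := [Choice of ZL n by <:].
HB.instance Definition _ n := [SubChoice_isSubLmodule of ZL n by <:].

Definition is_coboundary n : {pred ZL n} :=
  match n with
  | 0 => fun z => `[< z = 0 >]
  | m.+1 => fun z => `[< exists f : CL m, forall x, z x = delta f x >]
  end.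

Fact is_coboundary_submod_closed n : submod_closed (@is_coboundary n).
Proof.
case: n => [|n]; split.
- exact/asboolP.
- by move=> a u v /asboolP -> /asboolP ->; apply/asboolP; rewrite scaler0 addr0.
- by apply/asboolP; exists 0 => x; rewrite [RHS]delta0.
move=> a u v /asboolP[f hf] /asboolP[g hg]; apply/asboolP.
exists (a *: f + g) => x.
have /(congr1 (@^~ x)) -> := delta_linear a (f : _ -> _) (g : _ -> _).
by rewrite /= !fctE hf hg.
Qed.

HB.instance Definition _ n := GRing.isSubmodClosed.Build K (ZL n)
  (@is_coboundary n) (@is_coboundary_submod_closed n).

Definition HL n : Type := quotmod (@is_coboundary n).

HB.instance Definition _ n := GRing.Lmodule.on (HL n).

Definition represents n (f : CL n) (c : HL n) : Prop :=
  exists2 z : ZL n, f = z & quot_class _ z = c.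

End Cohomology.

Record base (K : fieldType) := Base {
  base_alg :> comAlgType K;
  aug : {lrmorphism base_alg -> K^o} }.

Record base_hom (K : fieldType) (A B : base K) := BaseHom {
  base_hom_fun :> A -> B;
  base_hom_linear : linear base_hom_fun;
  base_hom_monoid : monoid_morphism base_hom_fun;
  base_hom_aug : forall a, aug B (base_hom_fun a) = aug A a }.

Lemma base_hom_ext (K : fieldType) (A B : base K) (f g : base_hom A B) :
  f =1 g -> f = g.
Proof.
case: f g => [f f1 f2 f3] [g g1 g2 g3] /= /funext fg.
by case: _ / fg in g1 g2 g3 *; congr BaseHom; exact: Prop_irrelevance.
Qed.

Section Local.
Variable A : comNzRingType.

Definition is_ideal (I : A -> Prop) : Prop :=
  I 0 /\ forall a x y, I x -> I y -> I (a * x + y).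

Definition is_maximal_ideal (I : A -> Prop) : Prop :=
  [/\ is_ideal I, ~ I 1 & forall J, is_ideal J -> (forall x, I x -> J x) ->
    J 1 \/ (forall x, J x -> I x)].

Definition is_local_with (M : A -> Prop) : Prop :=
  is_maximal_ideal M /\
  forall J, is_maximal_ideal J -> forall x, J x <-> M x.

Definition ideal_mul (I J : A -> Prop) : A -> Prop := fun z =>
  exists n (x y : 'I_n -> A),
    [/\ forall i, I (x i), forall i, J (y i) & z = \sum_i x i * y i].

End Local.

Section SquareZero.
Variables (K : fieldType) (V : lmodType K).

Definition sqzero : Type := (K^o * V)%type.

HB.instance Definition _ := GRing.Lmodule.on sqzero.

Definition sqzero_one : sqzero := (1, 0).

Definition sqzero_mul (x y : sqzero) : sqzero :=
  (x.1 * y.1, x.1 *: y.2 + y.1 *: x.2).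

Fact sqzero_mulA : associative sqzero_mul.
Proof.
move=> [a u] [b v] [c w]; rewrite /sqzero_mul /=; congr (_, _).
  exact: mulrA.
by rewrite !scalerDr !scalerA addrA [c * a]mulrC [c * b]mulrC.
Qed.

Fact sqzero_mulC : commutative sqzero_mul.
Proof.
by move=> [a u] [b v]; rewrite /sqzero_mul /= addrC [a * b]mulrC.
Qed.

Fact sqzero_mul1 : left_id sqzero_one sqzero_mul.
Proof.
by move=> [a u]; rewrite /sqzero_mul /= mul1r scale1r scaler0 addr0.
Qed.

Fact sqzero_mulD : left_distributive sqzero_mul +%R.
Proof.
move=> [a u] [b v] [c w]; congr (_, _) => /=; first exact: mulrDl.
by rewrite scalerDl scalerDr addrACA.
Qed.

Fact sqzero_one_neq0 : sqzero_one != 0.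
Proof. by apply/eqP => -[] /eqP; rewrite oner_eq0. Qed.

HB.instance Definition _ := GRing.Zmodule_isComNzRing.Build sqzero
  sqzero_mulA sqzero_mulC sqzero_mul1 sqzero_mulD sqzero_one_neq0.

Fact sqzero_scaleAl (a : K) (x y : sqzero) : a *: (x * y) = (a *: x) * y.
Proof.
case: x y => [b u] [c v]; congr (_, _) => /=; first exact: mulrA.
by rewrite scalerDr !scalerA [a * c]mulrC.
Qed.

HB.instance Definition _ :=
  GRing.Lmodule_isLalgebra.Build K sqzero sqzero_scaleAl.
HB.instance Definition _ := GRing.Lalgebra_isComAlgebra.Build K sqzero.

Definition sqzero_aug (x : sqzero) : K^o := x.1.

Fact sqzero_aug_linear : linear sqzero_aug. Proof. by []. Qed.
Fact sqzero_aug_monoid : monoid_morphism sqzero_aug. Proof. by []. Qed.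

HB.instance Definition _ :=
  GRing.isLinear.Build K sqzero K^o *:%R sqzero_aug sqzero_aug_linear.
HB.instance Definition _ :=
  GRing.isMonoidMorphism.Build sqzero K^o sqzero_aug sqzero_aug_monoid.

Definition sqzero_base : base K := Base sqzero_aug.

Definition sqzero_inr (v : V) : sqzero := (0, v).

End SquareZero.

Section ScalarExtension.
Variables (K : fieldType) (A : comAlgType K) (L : lmodType K).

(* An alias of [tensor A L], carrying its A-module rather than its K-module
   structure. *)
Definition extend : Type := tensor A L.

HB.instance Definition _ := GRing.Zmodule.on extend.

Definition ext_tens (a : A) (l : L) : extend := tens a l.

Definition ext_scale (a : A) (t : extend) : extend :=
  tlift (fun b l => tens (a * b) l) t.

Fact ext_scale_bilinear a : is_bilinear (fun (b : A) (l : L) => tens (a * b) l).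
Proof.
split=> [l k b c|b k l m]; last exact: tens_linearr.
by rewrite mulrDr -scalerAr tens_linearl.
Qed.

Lemma ext_scaleE a b l : ext_scale a (ext_tens b l) = ext_tens (a * b) l.
Proof. exact: tliftE (ext_scale_bilinear a) _ _. Qed.

Fact ext_scaleDr : right_distributive ext_scale +%R.
Proof.
move=> a s t; have := tlift_linear (ext_scale_bilinear a) 1 s t.
by rewrite !scale1r.
Qed.

Lemma extend_ind (P : extend -> Prop) :
    (forall a l, P (ext_tens a l)) -> (forall s t, P s -> P t -> P (s + t)) ->
  forall t, P t.
Proof. exact: tensor_ind. Qed.

Fact ext_scaleA a b t : ext_scale a (ext_scale b t) = ext_scale (a * b) t.
Proof.
elim/extend_ind: t => [c l|s t hs ht]; first by rewrite !ext_scaleE mulrA.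
by rewrite !ext_scaleDr hs ht.
Qed.

Fact ext_scale1 : left_id 1 ext_scale.
Proof.
elim/extend_ind => [c l|s t hs ht]; first by rewrite ext_scaleE mul1r.
by rewrite ext_scaleDr hs ht.
Qed.

Fact ext_scaleDl t : {morph ext_scale^~ t : a b / a + b}.
Proof.
move=> a b; elim/extend_ind: t => [c l|s t hs ht].
  by rewrite !ext_scaleE mulrDl; exact: (bilinearDl (@tens_bilinear K A L)).
by rewrite !ext_scaleDr hs ht addrACA.
Qed.

HB.instance Definition _ := GRing.Zmodule_isLmodule.Build A extend
  ext_scaleA ext_scale1 ext_scaleDr ext_scaleDl.

Lemma ext_tensZ a b l : ext_tens (a * b) l = a *: ext_tens b l.
Proof. by rewrite [RHS]ext_scaleE. Qed.

Lemma ext_tensE a l : ext_tens a l = a *: ext_tens 1 l.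
Proof. by rewrite -ext_tensZ mulr1. Qed.

Lemma ext_scaleZl (k : K) (a : A) (t : extend) :
  (k *: a) *: t = (k *: (a *: t : tensor A L) : extend).
Proof.
elim/extend_ind: t => [b l|s t hs ht].
  by rewrite -!ext_tensZ -scalerAl; exact: (bilinearZl (@tens_bilinear K A L)).
by rewrite !scalerDr hs ht.
Qed.

Lemma ext_scaleZr (k : K) (a : A) (t : extend) :
  a *: (k *: (t : tensor A L) : extend) = (k *: (a *: t : tensor A L) : extend).
Proof.
have := ext_scaleZl k 1 t; rewrite scale1r => <-.
by rewrite scalerA -ext_scaleZl -scalerAr mulr1.
Qed.

End ScalarExtension.

Section ExtendMap.
Variables (K : fieldType) (L : lmodType K).

(* phi (x) id *)
Definition ext_map (A B : comAlgType K) (phi : A -> B) (t : extend A L) :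
  extend B L := tlift (fun a l => tens (phi a) l) t.

(* epsilon (x) id, with K (x) L identified with L *)
Definition ext_aug (A : base K) (t : extend A L) : L :=
  tlift (fun a l => aug A a *: l) t.

Section ExtMap.
Variables (A B : base K) (phi : base_hom A B).

Fact ext_map_bilinear : is_bilinear (fun (a : A) (l : L) => tens (phi a : B) l).
Proof.
split=> [l|a]; last exact: tens_linearr.
by move=> k a b; rewrite base_hom_linear tens_linearl.
Qed.

Lemma ext_mapE a l : ext_map phi (ext_tens a l) = ext_tens (phi a) l.
Proof. exact: tliftE ext_map_bilinear _ _. Qed.

Lemma ext_map_linear : linear (ext_map phi : tensor A L -> tensor B L).
Proof. exact: tlift_linear ext_map_bilinear. Qed.

Lemma ext_mapD s t : ext_map phi (s + t) = ext_map phi s + ext_map phi t.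
Proof. by have := ext_map_linear 1 s t; rewrite !scale1r. Qed.

Lemma ext_mapB s t : ext_map phi (s - t) = ext_map phi s - ext_map phi t.
Proof. by apply: (addIr (ext_map phi t)); rewrite -ext_mapD !subrK. Qed.

Lemma ext_mapZ a t : ext_map phi (a *: t) = phi a *: ext_map phi t.
Proof.
elim/extend_ind: t => [b l|s t hs ht]; last by rewrite scalerDr !ext_mapD scalerDr hs ht.
by rewrite -ext_tensZ !ext_mapE (base_hom_monoid phi).2 ext_tensZ.
Qed.

End ExtMap.

Section ExtAug.
Variable A : base K.

Fact ext_aug_bilinear : is_bilinear (fun (a : A) (l : L) => aug A a *: l).
Proof.
split=> [l k a b|a k l m]; first by rewrite linearP scalerDl -scalerA.
by rewrite scalerDr !scalerA mulrC.
Qed.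

Lemma ext_augE a l : ext_aug (ext_tens a l) = aug A a *: l.
Proof. exact: tliftE ext_aug_bilinear _ _. Qed.

Lemma ext_aug_linear : linear (@ext_aug A : tensor A L -> L).
Proof. exact: tlift_linear ext_aug_bilinear. Qed.

Lemma ext_augD s t : @ext_aug A (s + t) = ext_aug s + ext_aug t.
Proof. by have := ext_aug_linear 1 s t; rewrite !scale1r. Qed.

Lemma ext_augZ a t : @ext_aug A (a *: t) = aug A a *: ext_aug t.
Proof.
elim/extend_ind: t => [b l|s t hs ht]; last by rewrite scalerDr !ext_augD scalerDr hs ht.
by rewrite -ext_tensZ !ext_augE rmorphM scalerA.
Qed.

End ExtAug.

Lemma ext_aug_map (A B : base K) (phi : base_hom A B) t :
  ext_aug (ext_map phi t) = ext_aug t.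
Proof.
elim/extend_ind: t => [b l|s t hs ht]; last by rewrite ext_mapD !ext_augD hs ht.
by rewrite ext_mapE !ext_augE base_hom_aug.
Qed.

End ExtendMap.

Section BilinearExtension.
Variables (K : fieldType) (A : comAlgType K) (L : lmodType K).

(* The A-bilinear operation on A (x) L extending a K-bilinear [g], whose value
   on the pair 1 (x) l, 1 (x) m is [g l m]. *)
Definition ext_bracket (g : L -> L -> extend A L) (s t : extend A L) :
    extend A L :=
  tlift (fun a l => tlift (fun b m => (a * b) *: g l m : tensor A L) t) s.

Variable g : L -> L -> extend A L.
Hypothesis gB : is_bilinear (g : L -> L -> tensor A L).

Let term a b l m : tensor A L := (a * b) *: g l m.

Let term_bl a l : is_bilinear (term a ^~ l).
Proof.
split=> [m k b c|b k m n]; rewrite /term.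
  rewrite mulrDr -scalerAr scalerDl; congr (_ + _).
  exact: ext_scaleZl.
rewrite gB.2; rewrite [LHS]scalerDr; congr (_ + _); exact: ext_scaleZr.
Qed.

Let inner_bl t : is_bilinear (fun a l => tlift (term a ^~ l) t : tensor A L).
Proof.
split=> [l k a b|a k l m]; elim/tensor_ind: t => [c n|s t hs ht].
- rewrite !tliftE // /term mulrDl -scalerAl scalerDl; congr (_ + _).
  exact: ext_scaleZl.
- have D a' : tlift (term a' ^~ l) (s + t) =
      tlift (term a' ^~ l) s + tlift (term a' ^~ l) t.
    by have := tlift_linear (term_bl a' l) 1 s t; rewrite !scale1r.
  by rewrite !D hs ht scalerDr addrACA.
- rewrite !tliftE // /term gB.1 [LHS]scalerDr; congr (_ + _).
  exact: ext_scaleZr.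
have D l' : tlift (term a ^~ l') (s + t) =
    tlift (term a ^~ l') s + tlift (term a ^~ l') t.
  by have := tlift_linear (term_bl a l') 1 s t; rewrite !scale1r.
by rewrite !D hs ht scalerDr addrACA.
Qed.

Lemma ext_bracketE a b l m :
  ext_bracket g (ext_tens a l) (ext_tens b m) = (a * b) *: g l m.
Proof. by rewrite /ext_bracket (tliftE (inner_bl _)) (tliftE (term_bl _ _)). Qed.

Let ext_bracketDl r s t :
  ext_bracket g (r + s) t = ext_bracket g r t + ext_bracket g s t.
Proof. by have := tlift_linear (inner_bl t) 1 r s; rewrite !scale1r. Qed.

Let ext_bracketDr r s t :
  ext_bracket g r (s + t) = ext_bracket g r s + ext_bracket g r t.
Proof.
elim/extend_ind: r => [a l|r r' hr hr']; last first.
  by rewrite !ext_bracketDl hr hr' addrACA.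
rewrite /ext_bracket !(tliftE (inner_bl _)).
by have := tlift_linear (term_bl a l) 1 s t; rewrite !scale1r.
Qed.

Let ext_bracketZl a s t : ext_bracket g (a *: s) t = a *: ext_bracket g s t.
Proof.
elim/extend_ind: s => [b l|s s' hs hs']; last first.
  by rewrite scalerDr !ext_bracketDl hs hs' scalerDr.
elim/extend_ind: t => [c m|t t' ht ht']; last first.
  by rewrite !ext_bracketDr ht ht' scalerDr.
by rewrite -ext_tensZ !ext_bracketE scalerA mulrA.
Qed.

Let ext_bracketZr a s t : ext_bracket g s (a *: t) = a *: ext_bracket g s t.
Proof.
elim/extend_ind: s => [b l|s s' hs hs']; last first.
  by rewrite !ext_bracketDl hs hs' scalerDr.
elim/extend_ind: t => [c m|t t' ht ht']; last first.
  by rewrite scalerDr !ext_bracketDr ht ht' scalerDr.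
by rewrite -ext_tensZ !ext_bracketE scalerA mulrCA.
Qed.

Lemma ext_bracket_bilinear : is_bilinear (ext_bracket g).
Proof.
split=> [t a r s|r a s t]; first by rewrite ext_bracketDl ext_bracketZl.
by rewrite ext_bracketDr ext_bracketZr.
Qed.

Lemma ext_bracket_leibniz :
    (forall l m n, ext_bracket g (ext_tens 1 l) (g m n) =
      ext_bracket g (g l m) (ext_tens 1 n) -
      ext_bracket g (g l n) (ext_tens 1 m)) ->
  is_leibniz (ext_bracket g).
Proof.
move=> gL; split; first exact: ext_bracket_bilinear.
move=> x y z; elim/extend_ind: x => [a l|x x' hx hx']; last first.
  by rewrite !ext_bracketDl hx hx' opprD addrACA.
elim/extend_ind: y => [b m|y y' hy hy']; last first.
  by rewrite !(ext_bracketDl, ext_bracketDr) hy hy' opprD addrACA.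
elim/extend_ind: z => [c n|z z' hz hz']; last first.
  by rewrite !(ext_bracketDl, ext_bracketDr) hz hz' opprD addrACA.
have E1 l' m' : ext_bracket g (ext_tens 1 l') (ext_tens 1 m') = g l' m'.
  by rewrite ext_bracketE mulr1 scale1r.
rewrite (ext_tensE a) (ext_tensE b) (ext_tensE c).
rewrite !(ext_bracketZl, ext_bracketZr, E1) gL !scalerBr !scalerA.
by congr (_ *: _ - _ *: _); ring.
Qed.

End BilinearExtension.

Section Deformations.
Variables (K : fieldType) (L : leibniz_alg K).

Record deformation (A : base K) := Deformation {
  dbracket : extend A L -> extend A L -> extend A L;
  dbracket_leibniz : is_leibniz dbracket;
  dbracket_aug : forall s t,
    ext_aug (dbracket s t) = bracket (ext_aug s) (ext_aug t) }.

Definition infinitesimal (A : base K) (lam : deformation A) : Prop :=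
  let M := fun a : A => aug A a = 0 in
  is_local_with M /\ forall a, ideal_mul M M a <-> a = 0.

Definition equivalent (A : base K) (lam1 lam2 : deformation A) : Prop :=
  exists rho : {linear extend A L -> extend A L},
    [/\ bijective rho,
        forall s t, rho (dbracket lam1 s t) = dbracket lam2 (rho s) (rho t)
      & forall t, ext_aug (rho t) = ext_aug t].

Lemma ext_bracket_aug (A : base K) (g : L -> L -> extend A L) :
    is_bilinear (g : L -> L -> tensor A L) ->
    (forall l m, ext_aug (g l m) = bracket l m) ->
  forall s t, ext_aug (ext_bracket g s t) = bracket (ext_aug s) (ext_aug t).
Proof.
move=> gB gaug s t; have eB := ext_bracket_bilinear gB.
have bB := (bracket_leibniz L).1.
elim/extend_ind: s => [a l|s s' hs hs']; last first.
  by rewrite (bilinearDl eB) !ext_augD hs hs' (bilinearDl bB).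
elim/extend_ind: t => [b m|t t' ht ht']; last first.
  by rewrite (bilinearDr eB) !ext_augD ht ht' (bilinearDr bB).
rewrite (ext_bracketE gB) ext_augZ gaug !ext_augE.
by rewrite (bilinearZl bB) (bilinearZr bB) rmorphM scalerA.
Qed.

Section PushOut.
Variables (A B : base K) (phi : base_hom A B) (lam : deformation A).

Definition push_out_bracket : extend B L -> extend B L -> extend B L :=
  ext_bracket (fun l m =>
    ext_map phi (dbracket lam (ext_tens 1 l) (ext_tens 1 m))).

Let g l m := ext_map phi (dbracket lam (ext_tens 1 l) (ext_tens 1 m)).

Let dbr_Kbilinear : is_bilinear (dbracket lam : tensor A L -> tensor A L -> tensor A L).
Proof.
have [[bl br] _] := dbracket_leibniz lam.
have alg1 k (x : extend A L) : (k *: (x : tensor A L) : extend A L) = (k *: (1 : A)) *: x.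
  by rewrite ext_scaleZl scale1r.
split=> t k x y.
  by rewrite [k *: x]alg1 [X in _ = X + _]alg1; exact: bl.
by rewrite [k *: x]alg1 [X in _ = X + _]alg1; exact: br.
Qed.

Let gB : is_bilinear (g : L -> L -> tensor B L).
Proof.
split=> [m k x y|m k x y]; rewrite /g -ext_map_linear; congr (ext_map _ _).
  by rewrite -dbr_Kbilinear.1 [ext_tens 1 (_ + _)]tens_linearr.
by rewrite -dbr_Kbilinear.2 [ext_tens 1 (_ + _)]tens_linearr.
Qed.

Let ext_map_hom s t : ext_bracket g (ext_map phi s) (ext_map phi t) =
  ext_map phi (dbracket lam s t).
Proof.
have eB := ext_bracket_bilinear gB.
have [lB _] := dbracket_leibniz lam.
elim/extend_ind: s => [a l|s s' hs hs']; last first.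
  by rewrite ext_mapD (bilinearDl eB) hs hs' -ext_mapD -(bilinearDl lB).
elim/extend_ind: t => [b m|t t' ht ht']; last first.
  by rewrite ext_mapD (bilinearDr eB) ht ht' -ext_mapD -(bilinearDr lB).
rewrite !ext_mapE (ext_bracketE gB) /g -(base_hom_monoid phi).2 -ext_mapZ.
congr (ext_map _ _); rewrite [in RHS](ext_tensE a) [in RHS](ext_tensE b).
by rewrite (bilinearZl lB) (bilinearZr lB) scalerA.
Qed.

Fact push_out_leibniz : is_leibniz push_out_bracket.
Proof.
apply: (ext_bracket_leibniz gB) => l m n.
have one x : ext_tens 1 x = ext_map phi (ext_tens 1 x).
  by rewrite ext_mapE (base_hom_monoid phi).1.
rewrite 3!one !ext_map_hom (dbracket_leibniz lam).2.
by rewrite ext_mapB.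
Qed.

Fact push_out_aug s t :
  ext_aug (push_out_bracket s t) = bracket (ext_aug s) (ext_aug t).
Proof.
apply: ext_bracket_aug => // l m.
by rewrite ext_aug_map dbracket_aug !ext_augE rmorph1 !scale1r.
Qed.

Definition push_out : deformation B := Deformation push_out_leibniz push_out_aug.

Lemma push_outE l m : dbracket push_out (ext_tens 1 l) (ext_tens 1 m) =
  ext_map phi (dbracket lam (ext_tens 1 l) (ext_tens 1 m)).
Proof. by rewrite /= /push_out_bracket (ext_bracketE gB) mulr1 scale1r. Qed.

End PushOut.
End Deformations.

Section FirstOrderDeformations.
Variables (K : fieldType) (L : leibniz_alg K).

Definition eval2 (f : ('I_2 -> L) -> L) (l m : L) : L := f (tnth [tuple l; m]).

Lemma eval2_bilinear (f : CL L 2) : is_bilinear (eval2 f).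
Proof.
have /asboolP fL := cochain_multilinear f.
have upd0 (l m u : L) : upd (tnth [tuple l; m]) ord0 u = tnth [tuple u; m].
  by apply/funext => -[[|[|//]] ?]; rewrite /upd !(tnth_nth 0).
have upd1 (l m u : L) : upd (tnth [tuple l; m]) ord_max u = tnth [tuple l; u].
  by apply/funext => -[[|[|//]] ?]; rewrite /upd !(tnth_nth 0).
split=> [m a u v|l a u v]; rewrite /eval2.
  by have := fL (tnth [tuple 0; m]) ord0 a u v; rewrite !upd0.
by have := fL (tnth [tuple l; 0]) ord_max a u v; rewrite !upd1.
Qed.

Lemma cocycle2E (z : ZL L 2) (x y w : L) (f := eval2 z) :
  bracket x (f y w) + f x (bracket y w) =
  bracket (f x y) w + f (bracket x y) w
  - (bracket (f x w) y + f (bracket x w) y).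
Proof.
have /asboolP/(_ (tnth [tuple x; y; w])) := cocycle_closed z.
rewrite /delta.
rewrite [X in _ + X + _]big_mkcond /=.
under [X in _ + _ + X]eq_bigr do rewrite big_mkcond /=.
rewrite !(big_ord_recl, big_ord0) /=.
rewrite !(add0r, addr0) !exprS !expr0 !(mulr1, mulN1r, opprK, scaleN1r, scale1r).
have evalE F : z F = f (F ord0) (F (lift ord0 ord0)).
  congr (z _); apply/funext => -[[|[|//]] ?]; rewrite (tnth_nth 0) /=;
    by congr F; apply: val_inj.
rewrite !evalE /upd /= !(tnth_nth 0) /= => h.
apply/eqP; rewrite -subr_eq0; apply/eqP; rewrite -[RHS]h !opprD !opprK.
by rewrite !addrA [LHS](ACl (1*5*3*4*6*2)).
Qed.

Section FirstOrder.
Variables (A : base K) (n : nat) (c : 'I_n -> A) (f : 'I_n -> CL L 2).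

Definition first_order (l m : L) : extend A L :=
  ext_tens 1 (bracket l m) + \sum_i ext_tens (c i) (eval2 (f i) l m).

Local Notation e := first_order.

Lemma first_order_bilinear : is_bilinear (e : L -> L -> tensor A L).
Proof.
have bB := (bracket_leibniz L).1; have fB i := eval2_bilinear (f i).
pose tB := @tens_bilinear K A L.
pose e' l m : tensor A L := tens (1 : A) (bracket l m)
    + \sum_i tens (c i) (eval2 (f i) l m).
suff: is_bilinear e' by [].
split=> [m a x y|l a x y]; rewrite /e'.
  rewrite bB.1 tB.2 scalerDr addrACA scaler_sumr -big_split /=; congr (_ + _).
  by apply: eq_bigr => i _; rewrite (fB i).1 tB.2.
rewrite bB.2 tB.2 scalerDr addrACA scaler_sumr -big_split /=; congr (_ + _).
by apply: eq_bigr => i _; rewrite (fB i).2 tB.2.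
Qed.

Let eB := first_order_bilinear.

Lemma first_order_leibniz :
    (forall i j, c i * c j = 0) -> (forall i, f i \in @is_cocycle K L 2) ->
  is_leibniz (ext_bracket e).
Proof.
move=> cM fZ; pose tB := @tens_bilinear K A L.
have bB := ext_bracket_bilinear eB.
have ce i x y : c i *: e x y = ext_tens (c i) (bracket x y).
  rewrite scalerDr -ext_tensZ mulr1 scaler_sumr big1 ?addr0 // => j _.
  by rewrite -ext_tensZ cM; exact: (bilinear0l tB).
have eM x y w : ext_bracket e (ext_tens 1 x) (e y w) =
    e x (bracket y w)
    + \sum_i ext_tens (c i) (bracket x (eval2 (f i) y w)).
  rewrite {2}/e (bilinearDr bB) (bilinear_sumr bB) (ext_bracketE eB).
  rewrite mul1r scale1r; congr (_ + _); apply: eq_bigr => i _.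
  by rewrite (ext_bracketE eB) mul1r ce.
have Me x y w : ext_bracket e (e x y) (ext_tens 1 w) =
    e (bracket x y) w
    + \sum_i ext_tens (c i) (bracket (eval2 (f i) x y) w).
  rewrite {2}/e (bilinearDl bB) (bilinear_suml bB) (ext_bracketE eB).
  rewrite mul1r scale1r; congr (_ + _); apply: eq_bigr => i _.
  by rewrite (ext_bracketE eB) mulr1 ce.
have tD (a : A) (u v : L) : ext_tens a (u + v) = ext_tens a u + ext_tens a v.
  exact: bilinearDr tB a u v.
have tN (a : A) (u v : L) : ext_tens a (u - v) = ext_tens a u - ext_tens a v.
  by apply: (addIr (ext_tens a v)); rewrite -tD !subrK.
apply: (ext_bracket_leibniz eB) => x y w; rewrite eM !Me /e.
rewrite (bracket_leibniz L).2 tN -![_ + _ + \sum_i _]addrA -!big_split /=.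
rewrite opprD [RHS]addrACA -sumrB; congr (_ + _); apply: eq_bigr => i _.
rewrite -!tD -tN addrC (cocycle2E (Cocycle (fZ i))) /=.
by rewrite [X in _ - X]addrC [X in X - _]addrC.
Qed.

Lemma first_order_aug : (forall i, aug A (c i) = 0) ->
  forall s t, ext_aug (ext_bracket e s t) = bracket (ext_aug s) (ext_aug t).
Proof.
move=> c0; apply: (ext_bracket_aug eB) => l m.
have aug_sum F : ext_aug (\sum_i F i : extend A L) = \sum_(i < n) ext_aug (F i).
  apply: (big_morph _ (@ext_augD K L A)).
  by apply: (addrI (ext_aug (0 : extend A L))); rewrite -ext_augD !addr0.
rewrite ext_augD ext_augE rmorph1 scale1r aug_sum big1 ?addr0 // => i _.
by rewrite ext_augE c0 scale0r.
Qed.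

End FirstOrder.

Definition C1 : base K := sqzero_base (dual (HL L 2)).

Section Eta1.
Variables (n : nat) (h : 'I_n -> HL L 2) (g : 'I_n -> dual (HL L 2)).
Variable mu : {linear HL L 2 -> CL L 2}.
Hypothesis mu_repr : forall c, represents (mu c) c.

(* The bracket of C1 (x) L whose value on 1 (x) l, 1 (x) m is
   1 (x) [l, m] + \sum_i g_i (x) mu(h_i)(l, m). *)
Definition eta1_bracket : extend C1 L -> extend C1 L -> extend C1 L :=
  ext_bracket (first_order (fun i => sqzero_inr (g i) : C1) (mu \o h)).

Fact eta1_leibniz : is_leibniz eta1_bracket.
Proof.
apply: first_order_leibniz => [i j|i].
  by congr (_, _); rewrite /= ?mul0r // !scale0r addr0.
by have [z /= -> _] := mu_repr (h i); exact: cocycle_closed.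
Qed.

Fact eta1_aug s t :
  ext_aug (eta1_bracket s t) = bracket (ext_aug s) (ext_aug t).
Proof. exact: first_order_aug. Qed.

Definition eta1 : deformation L C1 := Deformation eta1_leibniz eta1_aug.

Lemma eta1E l m : dbracket eta1 (ext_tens 1 l) (ext_tens 1 m) =
  ext_tens 1 (bracket l m)
  + \sum_i ext_tens (sqzero_inr (g i) : C1) (eval2 (mu (h i)) l m).
Proof.
by rewrite [LHS](ext_bracketE (first_order_bilinear _ _)) mulr1 scale1r.
Qed.

End Eta1.
End FirstOrderDeformations.

(* Main.v *)
(* Since M^2 = 0, the linear forms alpha on A with alpha(1) = 0 are exactly the
   derivations at the augmentation. Applying alpha (x) id to the bracket of a
   deformation and to its Leibniz identity yields a 2-cocycle, hence a class in
   HL^2(L; L) depending linearly on alpha. Two deformations are equivalent iff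
   all these classes agree: the coboundaries are those of (alpha (x) id) o rho
   on 1 (x) L, and conversely, for m_k spanning M, primitives r_k assemble to
   the isomorphism t |-> t + \sum_k m_k (x) r_k(eps t). The class of
   phi_* eta_1 at alpha is \sum_i alpha(phi(g_i)) h_i, so the classes of lambda
   determine phi on the g_i, and define it. *)
Require Import Defs.
From HB Require Import structures.
From mathcomp Require Import freeg.
From mathcomp Require Import all_boot all_algebra.
From mathcomp Require Import boolp functions.

Set Implicit Arguments.
Unset Strict Implicit.
Unset Printing Implicit Defensive.

Import GRing.Theory.
Local Open Scope ring_scope.

(** * Coordinates and dual bases *)

Definition pack_linear (R : nzRingType) (U V : lmodType R) (f : U -> V)
    (fL : linear f) : {linear U -> V} :=
  HB.pack_for {linear U -> V} f (GRing.isLinear.Build R U V *:%R f fL).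

(** Coordinates are picked by choice. They are linear because combining the coordinates of [u] and
    [v] gives an expansion of [a *: u + v], and expansions are unique. *)
Lemma basis_coord (K : comNzRingType) (V : lmodType K) n (b : 'I_n -> V) :
  is_basis b ->
  exists c : 'I_n -> {linear V -> K^o}, forall v, v = \sum_i c i v *: b i.
Proof.
move=> bB.
have /choice[c cP] : forall v, exists c : {ffun 'I_n -> K}, v = \sum_i c i *: b i.
  by move=> v; have [c [cP _]] := bB v; exists c.
have cL i : linear (fun v => c v i : K^o).
  move=> a u v; have [d [_ dU]] := bB (a *: u + v).
  have e : a *: u + v = \sum_i [ffun j => a * c u j + c v j] i *: b i.
    rewrite {1}(cP u) {1}(cP v) scaler_sumr -big_split /=.
    by apply: eq_bigr => j _; rewrite ffunE scalerDl scalerA.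
  by rewrite -(dU _ (cP _)) (dU _ e) ffunE.
by exists (fun i => pack_linear (cL i)).
Qed.

Lemma basis_free (K : comNzRingType) (V : lmodType K) n (b : 'I_n -> V)
    (x y : 'I_n -> K) : is_basis b ->
  \sum_i x i *: b i = \sum_i y i *: b i -> x =1 y.
Proof.
move=> bB xy i; have [d [_ dU]] := bB (\sum_i x i *: b i).
have /ffunP/(_ i) : [ffun i => x i] = [ffun i => y i].
  transitivity d; [symmetry|]; apply: dU; last rewrite xy.
    by apply: eq_bigr => j _; rewrite ffunE.
  by apply: eq_bigr => j _; rewrite ffunE.
by rewrite !ffunE.
Qed.

Lemma dual_linearE (K : comNzRingType) (V : lmodType K) (xi : dual V) : linear xi.
Proof. exact/asboolP/(dual_linear xi). Qed.

Lemma dual_sumE (K : comNzRingType) (V : lmodType K) (xi : dual V) n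
    (x : 'I_n -> K) (b : 'I_n -> V) :
  xi (\sum_i x i *: b i) = \sum_i x i * xi (b i).
Proof.
pose f := pack_linear (dual_linearE xi).
transitivity (f (\sum_i x i *: b i)); first by [].
by rewrite linear_sum; apply: eq_bigr => i _; exact: linearZ.
Qed.

Section DualBasis.
Variables (K : comNzRingType) (V : lmodType K) (n : nat).
Variables (b : 'I_n -> V) (g : 'I_n -> dual V).
Hypotheses (b_basis : is_basis b) (g_dual : is_dual_basis b g).

Lemma dual_basis_coord v : v = \sum_i g i v *: b i.
Proof.
have [c cP] := basis_coord b_basis; rewrite {1}(cP v); apply: eq_bigr => i _.
rewrite {2}(cP v) dual_sumE (bigD1 i) //= g_dual eqxx mulr1 big1 ?addr0 //.
by move=> j ji; rewrite g_dual eq_sym (negPf ji) mulr0.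
Qed.

Lemma dual_basis_span (xi : dual V) : xi = \sum_i (xi (b i) : K) *: g i.
Proof.
apply: val_inj; rewrite raddf_sum /=; apply/funext => v.
rewrite {1}(dual_basis_coord v) dual_sumE fct_sumE.
by apply: eq_bigr => i _; rewrite mulrC.
Qed.

End DualBasis.

(** * Contraction of A (x) L with linear forms on A *)

Section Coefficient.
Variables (K : fieldType) (A : comAlgType K) (L : lmodType K).

(* alpha (x) id, with K (x) L identified with L *)
Definition coef (alpha : A -> K^o) (t : extend A L) : L :=
  tlift (fun a l => alpha a *: l) t.

Variable alpha : {linear A -> K^o}.

Let coef_bilinear : is_bilinear (fun (a : A) (l : L) => alpha a *: l).
Proof.
split=> [l k a b|a k l m]; first by rewrite linearP scalerDl -scalerA.
by rewrite scalerDr !scalerA mulrC.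
Qed.

Lemma coefE a l : coef alpha (ext_tens a l) = alpha a *: l.
Proof. exact: tliftE coef_bilinear _ _. Qed.

Lemma coef_linear : linear (coef alpha : tensor A L -> L).
Proof. exact: tlift_linear coef_bilinear. Qed.

Lemma coefD s t : coef alpha (s + t) = coef alpha s + coef alpha t.
Proof. by have := coef_linear 1 s t; rewrite !scale1r. Qed.

Lemma coefB s t : coef alpha (s - t) = coef alpha s - coef alpha t.
Proof. by apply: (addIr (coef alpha t)); rewrite -coefD !subrK. Qed.

Lemma coef_sum (I : finType) (F : I -> extend A L) :
  coef alpha (\sum_i F i) = \sum_i coef alpha (F i).
Proof.
apply: (big_morph _ coefD).
by apply: (addrI (coef alpha 0)); rewrite -coefD !addr0.
Qed.

End Coefficient.

Lemma coef_map (K : fieldType) (A B : base K) (L : lmodType K)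
    (phi : base_hom A B) (alpha : {linear B -> K^o}) (beta : {linear A -> K^o})
    (t : extend A L) :
  (forall a, beta a = alpha (phi a)) -> coef alpha (ext_map phi t) = coef beta t.
Proof.
move=> ab; elim/extend_ind: t => [a l|s t hs ht]; last first.
  by rewrite ext_mapD !coefD hs ht.
by rewrite ext_mapE !coefE ab.
Qed.

(** * Bases whose augmentation ideal M has square zero *)

Section SquareZeroBase.
Variables (K : fieldType) (A : base K).
Hypothesis sqM : forall a b, aug A a = 0 -> aug A b = 0 -> a * b = 0.

Lemma aug_alg (k : K) : aug A (k%:A) = k.
Proof. by rewrite linearZ rmorph1 [LHS]mulr1. Qed.

(** Apply [alpha] to (a - eps a)(b - eps b) = 0; the term in eps a eps b vanishes with [alpha 1]. *)
Lemma tangentM (alpha : {linear A -> K^o}) a b : alpha 1 = 0 ->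
  alpha (a * b) = aug A a * alpha b + alpha a * aug A b.
Proof.
move=> a1.
have : (a - (aug A a)%:A) * (b - (aug A b)%:A) = 0.
  by apply: sqM; rewrite raddfB /= aug_alg subrr.
rewrite mulrBl !mulrBr !mulr_algl !mulr_algr => /(congr1 alpha).
rewrite !raddfB raddf0 /= !linearZ a1 /= => /eqP.
rewrite !(oppr0, scaler0, addr0, scalerN) -addrA -opprD subr_eq0 => /eqP ->.
by rewrite addrC; congr (_ + _); exact: mulrC.
Qed.

Lemma aug0_mulr a b : aug A b = 0 -> a * b = aug A a *: b.
Proof.
move=> b0; apply/eqP; rewrite -subr_eq0 -mulr_algl -mulrBl sqM //.
by rewrite raddfB /= aug_alg subrr.
Qed.

(** The derivation rule [tangentM], carried over to A (x) L. *)
Lemma coefZ (L : lmodType K) (alpha : {linear A -> K^o}) a (t : extend A L) :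
  alpha 1 = 0 ->
  coef alpha (a *: t) = aug A a *: coef alpha t + alpha a *: ext_aug t.
Proof.
move=> a1; elim/extend_ind: t => [b l|s t hs ht].
  by rewrite -ext_tensZ !coefE ext_augE tangentM // scalerDl !scalerA.
by rewrite scalerDr !coefD ext_augD hs ht !scalerDr addrACA.
Qed.

End SquareZeroBase.

(** A basis of A is projected to M along K.1, and [c k] is the old coordinate taken after that
    projection. The [m k] span M but are dependent, being dim A in number, so [c k (m j)] is not a
    Kronecker symbol. *)
Lemma tangent_basis (K : fieldType) (A : base K) : finite_dim A ->
  exists N (m : 'I_N -> A) (c : 'I_N -> {linear A -> K^o}),
    [/\ forall k, aug A (m k) = 0, forall k, c k 1 = 0
      & forall a, a = (aug A a)%:A + \sum_k c k a *: m k].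
Proof.
move=> [N [b bB]]; have [c cP] := basis_coord bB.
pose d k (a : A) : K^o := c k (a - (aug A a)%:A).
have dL k : linear (d k).
  move=> x a a'; rewrite /d -linearP; congr (c k _).
  rewrite linearP scalerBr scalerDl scalerA opprD addrACA; congr (_ + _).
exists N, (fun k => b k - (aug A (b k))%:A).
exists (fun k => pack_linear (dL k)).
split=> [k|k|a] /=.
- by rewrite raddfB /= aug_alg subrr.
- by rewrite /d rmorph1 scale1r subrr raddf0.
have aug0 : aug A (a - (aug A a)%:A) = 0 by rewrite raddfB /= aug_alg subrr.
rewrite /d; set a' := a - _ in aug0 *.
have e : a' = \sum_k c k a' *: b k := cP a'.
(* Replacing [b k] by [m k] subtracts this multiple of 1, which is the augmentation of [a']. *)
have aug_sum : \sum_k c k a' * aug A (b k) = 0.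
  rewrite -[RHS]aug0 [in RHS]e linear_sum; apply: eq_bigr => k _; by rewrite linearZ.
under eq_bigr do rewrite scalerBr scalerA.
rewrite sumrB -e -scaler_suml aug_sum scale0r subr0.
by rewrite /a' addrC subrK.
Qed.

(** * Cochains and classes in low degree *)

Section LowCochains.
Variables (K : comNzRingType) (L : leibniz_alg K).

Definition bilin_cochain (f : L -> L -> L) (x : 'I_2 -> L) : L :=
  f (x ord0) (x ord_max).

Lemma bilin_cochain_multilinear f : is_bilinear f ->
  bilin_cochain f \in @is_multilinear K L 2.
Proof.
move=> fB; apply/asboolP => x k a u v; rewrite /bilin_cochain /upd.
case: k => -[|[|//]] k2.
  exact: (fB.1 (x ord_max) a u v).
exact: (fB.2 (x ord0) a u v).
Qed.

(** Converse of [cocycle2E]: the two sides of the hypothesis hold, up to sign, the six terms of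
    [delta]. *)
Lemma bilin_cochain_cocycle f :
    (forall x y w, bracket x (f y w) + f x (bracket y w) =
       bracket (f x y) w + f (bracket x y) w
       - (bracket (f x w) y + f (bracket x w) y)) ->
  forall x, delta (bilin_cochain f) x = 0.
Proof.
move=> fZ x.
(* On an explicit triple the sums and the maps [lift] compute. *)
have -> : x = tnth [tuple x (inord 0); x (inord 1); x (inord 2)].
  apply/funext => i; rewrite (tnth_nth 0).
  by case: i => -[|[|[|//]]] ? /=; congr x; apply: val_inj; rewrite /= inordK.
move: (x _) (x _) (x _) => w y v; rewrite /delta.
rewrite [X in _ + X + _]big_mkcond /=.
under [X in _ + _ + X]eq_bigr do rewrite big_mkcond /=.
rewrite !(big_ord_recl, big_ord0) /=.
rewrite !(add0r, addr0) !exprS !expr0 !(mulr1, mulN1r, opprK, scaleN1r, scale1r).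
rewrite /bilin_cochain /upd /= !(tnth_nth 0) /=.
have /eqP := fZ v y w; rewrite -subr_eq0 => /eqP h; rewrite -[RHS]h.
by rewrite !opprD !opprK !addrA [LHS](ACl (1*6*3*4*2*5)).
Qed.

Lemma multilinear1 (f : CL L 1) : linear (fun l => f (fun=> l)).
Proof.
have /asboolP fL := cochain_multilinear f.
have updE (l : L) : (fun=> l) = upd (fun=> 0) ord0 l :> ('I_1 -> L).
  by apply/funext => i; rewrite /upd ord1.
by move=> a u v; have := fL (fun=> 0) ord0 a u v; rewrite -!updE.
Qed.

Lemma linear_cochain_multilinear (f : L -> L) : linear f ->
  (fun x => f (x ord0)) \in @is_multilinear K L 1.
Proof.
move=> fL; apply/asboolP => x k a u v.
by rewrite /upd !(ord1 k) eqxx fL.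
Qed.

Lemma delta1E (f : ('I_1 -> L) -> L) (x : 'I_2 -> L)
    (f1 := fun l => f (fun=> l)) :
  delta f x = bracket (x ord0) (f1 (x ord_max)) + bracket (f1 (x ord0)) (x ord_max)
              - f1 (bracket (x ord0) (x ord_max)).
Proof.
have fE y : f y = f1 (y ord0).
  by congr (f _); apply/funext => i; rewrite ord1.
rewrite /delta !big_mkcond /=.
under [X in _ + _ + X]eq_bigr do rewrite big_mkcond /=.
rewrite !(big_ord_recl, big_ord0) /=.
rewrite !(add0r, addr0) !exprS !expr0 !(mulr1, mulN1r, opprK, scaleN1r, scale1r).
rewrite !fE /upd /=.
have -> : lift (lift ord0 ord0) ord0 = ord0 :> 'I_2 by apply: val_inj.
by have -> : lift ord0 ord0 = ord_max :> 'I_2 by apply: val_inj.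
Qed.

End LowCochains.

Lemma tnth_tuple2 (T : Type) (x : 'I_2 -> T) :
  tnth [tuple x ord0; x ord_max] = x.
Proof.
apply/funext => i; rewrite (tnth_nth (x ord0)); case: i => -[|[|//]] ? /=;
  by congr x; apply: val_inj.
Qed.

Section DegreeTwoClasses.
Variables (K : fieldType) (L : leibniz_alg K).

(** Degree-two coboundaries on plain functions, so that primitives can be chosen and summed without
    being packed as cochains. *)
Definition is_delta1 (r : L -> L) (f : L -> L -> L) : Prop :=
  linear r /\
  forall l m, f l m = bracket l (r m) + bracket (r l) m - r (bracket l m).

Lemma is_delta1_sum (I : finType) (a : I -> K) (r : I -> L -> L) f :
  (forall i, is_delta1 (r i) (f i)) ->
  is_delta1 (fun l => \sum_i a i *: r i l) (fun l m => \sum_i a i *: f i l m).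
Proof.
move=> rf; have bB := (bracket_leibniz L).1; split=> [k u v|l m].
  rewrite scaler_sumr -big_split; apply: eq_bigr => i _ /=.
  by rewrite (rf i).1 scalerDr !scalerA mulrC.
rewrite (bilinear_sumr bB) (bilinear_suml bB) -big_split -sumrB.
apply: eq_bigr => i _ /=.
by rewrite (rf i).2 (bilinearZr bB) (bilinearZl bB) -scalerDr -scalerBr.
Qed.

Lemma HL2_eq (z z' : ZL L 2) :
  quot_class (@is_coboundary K L 2) z = quot_class _ z' <->
  exists r, is_delta1 r (fun l m => @eval2 K L z l m - @eval2 K L z' l m).
Proof.
rewrite quot_classE; split=> [/asboolP[f hf]|[r [rL hr]]].
  exists (fun l => f (fun=> l)); split=> [|l m]; first exact: multilinear1.
  by have := hf (tnth [tuple l; m]); rewrite delta1E !(tnth_nth 0) /= => <-.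
apply/asboolP; exists (Cochain (linear_cochain_multilinear rL)) => x.
by rewrite delta1E /= -hr /eval2 tnth_tuple2.
Qed.

End DegreeTwoClasses.

(** * Tangent classes of a deformation *)

Section TangentCoefficients.
Variables (K : fieldType) (A : base K) (L : leibniz_alg K).
Hypothesis sqM : forall a b, aug A a = 0 -> aug A b = 0 -> a * b = 0.

Lemma ext_aug1 (l : L) : ext_aug (ext_tens (1 : A) l) = l.
Proof. by rewrite ext_augE rmorph1 scale1r. Qed.

(** [extend] carries the A-module structure, so a scalar of K acts on it through [k%:A]. *)
Lemma coef_algZ (alpha : {linear A -> K^o}) k (t : extend A L) :
  coef alpha (k%:A *: t) = k *: coef alpha t.
Proof.
elim/extend_ind: t => [a l|s t hs ht]; last first.
  by rewrite scalerDr !coefD hs ht scalerDr.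
by rewrite -ext_tensZ !coefE mulr_algl linearZ scalerA.
Qed.

Lemma ext_tens1_linear k (l m : L) :
  ext_tens (1 : A) (k *: l + m) = k%:A *: ext_tens 1 l + ext_tens 1 m.
Proof.
rewrite -ext_tensZ mulr1 /ext_tens tens_linearr; congr (_ + _).
by rewrite (bilinearZl (@tens_bilinear K A L)).
Qed.

Section Deformation.
Variable lam : deformation L A.

Definition tangent_bracket (alpha : A -> K^o) (l m : L) : L :=
  coef alpha (dbracket lam (ext_tens 1 l) (ext_tens 1 m)).

Lemma tangent_bracket_bilinear (alpha : {linear A -> K^o}) :
  is_bilinear (tangent_bracket alpha).
Proof.
have lB := (dbracket_leibniz lam).1.
split=> [m k u v|l k u v]; rewrite /tangent_bracket ext_tens1_linear.
  by rewrite lB.1 coefD coef_algZ.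
by rewrite lB.2 coefD coef_algZ.
Qed.

(** On pure tensors a and b come out of the bracket by A-bilinearity. The derivation [alpha] then
    falls on b, on a, or on the bracket of 1 (x) l and 1 (x) m, giving the three terms in this
    order. *)
Lemma coef_dbracket (alpha : {linear A -> K^o}) s t : alpha 1 = 0 ->
  coef alpha (dbracket lam s t) =
    bracket (ext_aug s) (coef alpha t) + bracket (coef alpha s) (ext_aug t)
    + tangent_bracket alpha (ext_aug s) (ext_aug t).
Proof.
move=> a1; have lB := (dbracket_leibniz lam).1.
have bB := (bracket_leibniz L).1; have tB := tangent_bracket_bilinear alpha.
elim/extend_ind: s => [a l|s s' hs hs']; last first.
  rewrite (bilinearDl lB) !coefD !ext_augD hs hs'.
  by rewrite !(bilinearDl bB) (bilinearDl tB) addrACA; congr (_ + _); rewrite addrACA.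
elim/extend_ind: t => [b m|t t' ht ht']; last first.
  rewrite (bilinearDr lB) !coefD !ext_augD ht ht'.
  by rewrite !(bilinearDr bB) (bilinearDr tB) addrACA; congr (_ + _); rewrite addrACA.
rewrite (ext_tensE a) (ext_tensE b) (bilinearZl lB) (bilinearZr lB).
rewrite !coefZ // !ext_augZ dbracket_aug !ext_aug1 !coefE a1 !scale0r !scaler0 !add0r.
rewrite (bilinearZl tB) (bilinearZr tB) !(bilinearZl bB) !(bilinearZr bB).
by rewrite scalerDr -addrA addrC.
Qed.

(** Contract the Leibniz identity at 1 (x) x, 1 (x) y, 1 (x) w. The contractions of these three
    elements vanish, so only the terms of the cocycle identity survive. *)
Lemma tangent_bracket_cocycle (alpha : {linear A -> K^o}) x y w
    (f := tangent_bracket alpha) : alpha 1 = 0 ->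
  bracket x (f y w) + f x (bracket y w) =
  bracket (f x y) w + f (bracket x y) w
  - (bracket (f x w) y + f (bracket x w) y).
Proof.
move=> a1; have bB := (bracket_leibniz L).1.
have := (dbracket_leibniz lam).2 (ext_tens 1 x) (ext_tens 1 y) (ext_tens 1 w).
move=> /(congr1 (coef alpha)); rewrite coefB !coef_dbracket // !dbracket_aug.
rewrite !ext_aug1 !coefE a1 !scale0r.
by rewrite !(bilinear0l bB) !(bilinear0r bB) !(addr0, add0r).
Qed.

Definition tangent_cochain (alpha : {linear A -> K^o}) : CL L 2 :=
  Cochain (bilin_cochain_multilinear (tangent_bracket_bilinear alpha)).

Lemma tangent_cochain_cocycle (alpha : {linear A -> K^o}) : alpha 1 = 0 ->
  tangent_cochain alpha \in @is_cocycle K L 2.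
Proof.
move=> a1; apply/asboolP/bilin_cochain_cocycle => x y w.
exact: tangent_bracket_cocycle.
Qed.

Definition tangent_cocycle (alpha : {linear A -> K^o}) (a1 : alpha 1 = 0) :
  ZL L 2 := Cocycle (tangent_cochain_cocycle a1).

(** The value at the tangent vector [alpha] of the Kodaira-Spencer map of [lam]. *)
Definition tangent_class (alpha : {linear A -> K^o}) (a1 : alpha 1 = 0) :
  HL L 2 := quot_class (@is_coboundary K L 2) (tangent_cocycle a1).

End Deformation.

Lemma tangent_cocycleE (lam : deformation L A) (alpha : {linear A -> K^o})
    (a1 : alpha 1 = 0) l m :
  @eval2 K L (tangent_cocycle lam a1) l m = tangent_bracket lam alpha l m.
Proof. by rewrite /eval2 /= /bilin_cochain !(tnth_nth 0). Qed.

Lemma equivalent_tangent_class (lam lam' : deformation L A)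
    (alpha : {linear A -> K^o}) (a1 : alpha 1 = 0) :
  equivalent lam lam' -> tangent_class lam a1 = tangent_class lam' a1.
Proof.
move=> [rho [_ rhoM rho_aug]]; apply/HL2_eq.
pose r l := coef alpha (rho (ext_tens 1 l)).
have rL : linear r.
  by move=> k l m; rewrite /r ext_tens1_linear linearP coefD coef_algZ.
have rZ k l : r (k *: l) = k *: r l by exact: (linearZ_LR (pack_linear rL)).
have rD l m : r (l + m) = r l + r m by exact: (raddfD (pack_linear rL)).
(* By A-linearity [rho] is determined on 1 (x) L, where it lifts the identity. Hence [coefZ] leaves
   [r] as the only correction. *)
have coef_rho t : coef alpha (rho t) = coef alpha t + r (ext_aug t).
  elim/extend_ind: t => [a l|s t hs ht]; last first.
    by rewrite raddfD !coefD ext_augD hs ht rD addrACA.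
  rewrite (ext_tensE a) linearZ !coefZ // rho_aug ext_augZ !ext_aug1 rZ.
  by rewrite coefE a1 scale0r scaler0 add0r addrC.
exists r; split=> // l m; rewrite !tangent_cocycleE.
have /(congr1 (coef alpha)) := rhoM (ext_tens 1 l) (ext_tens 1 m).
rewrite coef_rho dbracket_aug [RHS]coef_dbracket // !rho_aug !ext_aug1.
rewrite -/(tangent_bracket lam alpha l m) -/(r l) -/(r m) => /eqP.
rewrite -subr_eq => /eqP <-; rewrite -!addrA; congr (_ + _).
by rewrite addrC subrK.
Qed.

(** * Isomorphisms built from primitives along a spanning family of M *)

Section Gauge.
Variables (N : nat) (m : 'I_N -> A) (c : 'I_N -> {linear A -> K^o}).
Hypotheses (m0 : forall k, aug A (m k) = 0) (c1 : forall k, c k 1 = 0).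
Hypothesis mc : forall a, a = (aug A a)%:A + \sum_k c k a *: m k.

Lemma tangent_coord (alpha : {linear A -> K^o}) a : alpha 1 = 0 ->
  alpha a = \sum_k alpha (m k) * c k a.
Proof.
move=> a1; rewrite {1}(mc a) linearD linearZ a1 /= scaler0 add0r linear_sum.
by apply: eq_bigr => k _; rewrite linearZ; exact: mulrC.
Qed.

Lemma coef_coord (alpha : {linear A -> K^o}) (t : extend A L) : alpha 1 = 0 ->
  coef alpha t = \sum_k alpha (m k) *: coef (c k) t.
Proof.
move=> a1; elim/extend_ind: t => [a l|s t hs ht].
  rewrite coefE tangent_coord // scaler_suml.
  by apply: eq_bigr => k _; rewrite coefE scalerA.
rewrite coefD hs ht -big_split; apply: eq_bigr => k _ /=.
by rewrite coefD scalerDr.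
Qed.

(** [alpha] is the combination of the [c k] with coefficients [alpha (m k)], so the equality already
    holds between cochains. *)
Lemma tangent_class_coord (lam : deformation L A) (alpha : {linear A -> K^o})
    (a1 : alpha 1 = 0) :
  tangent_class lam a1 =
  \sum_k (alpha (m k) : K) *: tangent_class lam (c1 k).
Proof.
transitivity (quot_class (@is_coboundary K L 2)
    (\sum_k (alpha (m k) : K) *: tangent_cocycle lam (c1 k))); last first.
  by rewrite linear_sum; apply: eq_bigr => k _; exact: linearZ_LR.
congr quot_class; apply: val_inj; rewrite raddf_sum; apply: val_inj.
rewrite raddf_sum; apply/funext => x; rewrite fct_sumE.
exact: coef_coord.
Qed.

Lemma ext_coord (t : extend A L) :
  t = ext_tens 1 (ext_aug t) + \sum_k ext_tens (m k) (coef (c k) t).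
Proof.
have tB := @tens_bilinear K A L.
have tD (a : A) (u v : L) : ext_tens a (u + v) = ext_tens a u + ext_tens a v.
  exact: (bilinearDr tB).
elim/extend_ind: t => [a l|s t hs ht]; last first.
  rewrite {1}hs {1}ht ext_augD tD addrACA -big_split; congr (_ + _).
  by apply: eq_bigr => k _; rewrite coefD tD.
rewrite {1}(mc a) /ext_tens (bilinearDl tB) (bilinear_suml tB); congr (_ + _).
  by rewrite -[ext_aug _]/(ext_aug (ext_tens a l)) ext_augE (bilinearZl tB) (bilinearZr tB).
apply: eq_bigr => k _; rewrite -[tens a l]/(ext_tens a l) coefE.
by rewrite (bilinearZl tB) (bilinearZr tB).
Qed.

Lemma ext_eq (s t : extend A L) : ext_aug s = ext_aug t ->
  (forall k, coef (c k) s = coef (c k) t) -> s = t.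
Proof.
move=> st cst; rewrite (ext_coord s) (ext_coord t) st; congr (_ + _).
by apply: eq_bigr => k _; rewrite cst.
Qed.

(** The identity plus a map that factors through eps and takes values in M (x) L. *)
Definition gauge (r : 'I_N -> L -> L) (t : extend A L) : extend A L :=
  t + \sum_k ext_tens (m k) (r k (ext_aug t)).

Lemma coef_gauge (alpha : {linear A -> K^o}) r t :
  coef alpha (gauge r t) = coef alpha t + \sum_k alpha (m k) *: r k (ext_aug t).
Proof.
by rewrite coefD coef_sum; congr (_ + _); apply: eq_bigr => k _; rewrite coefE.
Qed.

Lemma gauge_aug r t : ext_aug (gauge r t) = ext_aug t.
Proof.
(* [ext_aug] is by definition the contraction with the augmentation. *)
rewrite -[LHS]/(coef (aug A) (gauge r t)) coef_gauge big1 ?addr0 // => k _.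
by rewrite /= m0 scale0r.
Qed.

(** The correction depends only on eps t, yet it is A-linear: [a * m k] equals [aug A a *: m k]
    since M^2 = 0. *)
Lemma gauge_linear r : (forall k, linear (r k)) -> linear (gauge r).
Proof.
move=> rL a s t; have tB := @tens_bilinear K A L.
rewrite /gauge scalerDr [RHS]addrACA; congr (_ + _).
rewrite scaler_sumr -big_split; apply: eq_bigr => k _ /=.
rewrite ext_augD ext_augZ rL -ext_tensZ aug0_mulr //.
by rewrite /ext_tens (bilinearDr tB) (bilinearZl tB) (bilinearZr tB).
Qed.

(** [gauge r] preserves eps t, so the second correction is the opposite of the first. *)
Lemma gauge_can r : cancel (gauge r) (gauge (fun k l => - r k l)).
Proof.
move=> t; rewrite {1}/gauge gauge_aug /gauge -addrA -big_split big1 ?addr0 // => k _ /=.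
have tB := @tens_bilinear K A L.
by rewrite /ext_tens -(bilinearDr tB) subrr (bilinear0r tB).
Qed.

Lemma gauge_bij r : bijective (gauge r).
Proof.
exists (gauge (fun k l => - r k l)); first exact: gauge_can.
move=> t; rewrite -[RHS](gauge_can (fun k l => - r k l)); congr (gauge _ _).
by apply/funext => k; apply/funext => l; rewrite opprK.
Qed.

Lemma tangent_class_equivalent (lam lam' : deformation L A) :
  (forall k, tangent_class lam (c1 k) = tangent_class lam' (c1 k)) ->
  equivalent lam lam'.
Proof.
move=> cls.
have /choice[r rP] k : exists r, is_delta1 r (fun l l' =>
    tangent_bracket lam (c k) l l' - tangent_bracket lam' (c k) l l').
  by have /HL2_eq[r rP] := cls k; exists r.
have rL k : linear (r k) := (rP k).1.
exists (pack_linear (gauge_linear rL)); split; first exact: gauge_bij.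
  move=> s t /=; apply: ext_eq => [|k].
    by rewrite !(gauge_aug, dbracket_aug).
  rewrite coef_gauge !coef_dbracket // !(gauge_aug, dbracket_aug) !coef_gauge.
  (* The [c k] coordinate of the gauge map involves every [r j], with weight [c k (m j)]. This
     weighted sum is a primitive of the weighted sum of the bracket differences, which [coef_coord]
     folds back into the difference at [c k]. *)
  have [_ /(_ (ext_aug s) (ext_aug t))] := is_delta1_sum (fun j => c k (m j)) rP.
  under eq_bigr do rewrite scalerBr.
  rewrite sumrB -!coef_coord // => /eqP.
  rewrite subr_eq => /eqP e; rewrite [tangent_bracket lam _ _ _]e.
  have bB := (bracket_leibniz L).1.
  rewrite (bilinearDr bB) (bilinearDl bB).
  rewrite [X in _ = X + _]addrACA -!addrA; do 4!congr (_ + _).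
  by rewrite addrC addrK.
by move=> t; exact: gauge_aug.
Qed.

End Gauge.

End TangentCoefficients.

(** * Homomorphisms out of C1 and push-outs of the universal deformation *)

Section Pushout.
Variables (K : fieldType) (A : base K) (L : leibniz_alg K).
Hypothesis sqM : forall a b, aug A a = 0 -> aug A b = 0 -> a * b = 0.
Variables (mu : {linear HL L 2 -> CL L 2}).
Hypothesis mu_repr : forall c : HL L 2, represents (mu c) c.
Variables (n : nat) (h : 'I_n -> HL L 2) (g : 'I_n -> dual (HL L 2)).

Definition C1_inr (xi : dual (HL L 2)) : C1 L := sqzero_inr xi.

(** Contracting a push-out with [alpha] is contracting with [alpha] composed with [phi]. On the
    formula for [eta1] this kills the term 1 (x) [l, m] and leaves a combination of the cocycles
    [mu (h i)], which represent the [h i]. *)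
Lemma tangent_class_push_out (phi : base_hom (C1 L) A)
    (alpha : {linear A -> K^o}) (a1 : alpha 1 = 0) :
  tangent_class sqM (push_out phi (eta1 h g mu_repr)) a1 =
  \sum_i (alpha (phi (C1_inr (g i))) : K) *: h i.
Proof.
have /choice[z zP] i : exists z : ZL L 2,
    mu (h i) = z /\ quot_class (@is_coboundary K L 2) z = h i.
  by have [z] := mu_repr (h i); exists z.
transitivity (quot_class (@is_coboundary K L 2)
    (\sum_i (alpha (phi (C1_inr (g i))) : K) *: z i)); last first.
  by rewrite linear_sum; apply: eq_bigr => i _; rewrite linearZ /= (zP i).2.
congr quot_class; apply: val_inj; rewrite raddf_sum; apply: val_inj.
rewrite raddf_sum; apply/funext => x; rewrite fct_sumE.
have betaL : linear (fun a : C1 L => alpha (phi a)).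
  by move=> k a b; rewrite base_hom_linear linearP.
pose beta := pack_linear betaL.
rewrite [LHS](_ : _ = tangent_bracket (push_out phi (eta1 h g mu_repr)) alpha
  (x ord0) (x ord_max)) // /tangent_bracket push_outE.
rewrite (@coef_map _ _ _ _ _ _ beta) // eta1E coefD coef_sum.
rewrite coefE [beta _](_ : _ = 0) ?scale0r ?add0r; last first.
  by rewrite /= (base_hom_monoid phi).1 a1.
by apply: eq_bigr => i _; rewrite coefE /= (zP i).1 /eval2 tnth_tuple2.
Qed.

Section ClassifyingMap.
Variables (N : nat) (m : 'I_N -> A) (u : 'I_N -> HL L 2).
Hypothesis m0 : forall k, aug A (m k) = 0.

(** On the dual of HL^2 this is contraction with the tensor \sum_k u_k (x) m_k. *)
Definition classifying (x : C1 L) : A :=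
  (x.1 : K)%:A + \sum_k (x.2 (u k) : K) *: m k.

Lemma classifying_linear : linear classifying.
Proof.
move=> k [a xi] [b zeta]; rewrite /classifying /= scalerDl -scalerA scalerDr.
rewrite [RHS]addrACA; congr (_ + _).
rewrite scaler_sumr -big_split; apply: eq_bigr => i _ /=.
by rewrite !fctE scalerDl scalerA.
Qed.

Lemma classifying_aug x : aug A (classifying x) = aug (C1 L) x.
Proof.
rewrite /classifying raddfD /= aug_alg linear_sum big1 ?addr0 // => k _.
by rewrite linearZ /= m0 scaler0.
Qed.

Lemma classifying_monoid : monoid_morphism classifying.
Proof.
split.
  by rewrite /classifying /= scale1r big1 ?addr0 // => k _; rewrite scale0r.
move=> [a xi] [b zeta]; rewrite /classifying /= mulrDl !mulrDr.
(* Both factors lie in M, matching the vanishing product of dual vectors in C1. *)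
have -> (s t : 'I_N -> K) : (\sum_k s k *: m k) * (\sum_k t k *: m k) = 0.
  by apply: sqM; rewrite linear_sum big1 // => k _; rewrite linearZ /= m0 scaler0.
rewrite addr0 !mulr_algl !mulr_algr !scaler_sumr scalerA -addrA; congr (_ + _).
rewrite -big_split; apply: eq_bigr => k _ /=.
by rewrite !fctE scalerDl !scalerA.
Qed.

Definition classifying_hom : base_hom (C1 L) A :=
  BaseHom classifying_linear classifying_monoid classifying_aug.

End ClassifyingMap.

Hypotheses (h_basis : is_basis h) (g_dual : is_dual_basis h g).

(** The unit and the [g i] span C1, by the dual basis expansion of [xi]. *)
Lemma C1_hom_eq (phi psi : base_hom (C1 L) A) :
  (forall i, phi (C1_inr (g i)) = psi (C1_inr (g i))) -> phi = psi.
Proof.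
move=> gE; apply: base_hom_ext => -[k xi].
have inrL : linear C1_inr.
  by move=> a x y; congr (_, _); rewrite /= scaler0 addr0.
have C1E : ((k, xi) : C1 L) = k%:A + \sum_i (xi (h i) : K) *: C1_inr (g i).
  transitivity (k%:A + C1_inr xi).
    by congr (_, _); rewrite /= ?scaler0 ?add0r ?addr0 //; exact/esym/mulr1.
  congr (_ + _); rewrite [in LHS](dual_basis_span h_basis g_dual xi).
  rewrite -[C1_inr]/(pack_linear inrL : _ -> _) linear_sum.
  by apply: eq_bigr => i _; exact: linearZ_LR.
have homE (f : base_hom (C1 L) A) :
    f (k, xi) = k%:A + \sum_i (xi (h i) : K) *: f (C1_inr (g i)).
  have fE : f =1 pack_linear (base_hom_linear f) by [].
  rewrite fE C1E linearD linearZ_LR linear_sum -fE (base_hom_monoid f).1.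
  by congr (_ + _); apply: eq_bigr => i _; exact: linearZ_LR.
by rewrite !homE; congr (_ + _); apply: eq_bigr => i _; rewrite gE.
Qed.

End Pushout.

(** * Existence and uniqueness of the classifying homomorphism *)

Lemma infinitesimal_sqzero (K : fieldType) (L : leibniz_alg K) (A : base K)
    (lam : deformation L A) : infinitesimal lam ->
  forall a b, aug A a = 0 -> aug A b = 0 -> a * b = 0.
Proof.
move=> [_ M2] a b a0 b0; apply/M2; exists 1, (fun=> a), (fun=> b).
by split; rewrite // big_ord1.
Qed.

Theorem proposition4p4 (K : fieldType) (K_char0 : [pchar K] =i pred0)
    (L : leibniz_alg K) (H_fin : finite_dim (HL L 2))
    (mu : {linear HL L 2 -> CL L 2})
    (mu_repr : forall c : HL L 2, represents (mu c) c)
    (n : nat) (h : 'I_n -> HL L 2) (h_basis : is_basis h)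
    (g : 'I_n -> dual (HL L 2)) (g_dual : is_dual_basis h g)
    (A : base K) (A_fin : finite_dim A)
    (lam : deformation L A) (lam_inf : infinitesimal lam) :
  exists! phi : base_hom (C1 L) A,
    equivalent lam (push_out phi (eta1 h g mu_repr)).
Proof.
have sqM := infinitesimal_sqzero lam_inf.
have [N [m [c [m0 c1 mc]]]] := tangent_basis A_fin.
pose u k := tangent_class sqM lam (c1 k).
pose phi0 := classifying_hom sqM u m0.
(* Equivalence becomes a system of equations in HL^2, one for each form [c k]. *)
have class_eqP (phi : base_hom (C1 L) A) :
    equivalent lam (push_out phi (eta1 h g mu_repr)) <->
    forall k, u k = \sum_i (c k (phi (C1_inr (g i))) : K) *: h i.
  split=> [e k|e].
    by rewrite -(tangent_class_push_out sqM mu_repr); exact: equivalent_tangent_class.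
  apply: (tangent_class_equivalent (c1 := c1) m0 mc) => k.
  by rewrite tangent_class_push_out -e.
have aug_inr (phi : base_hom (C1 L) A) xi : aug A (phi (C1_inr xi)) = 0.
  by rewrite base_hom_aug.
(* The [c k] coordinate of [phi0] at [g i] is \sum_j g_i(u_j) c_k(m_j). By [tangent_class_coord] at
   [c k] itself this is g_i(u_k), the coordinate of [u k] along [h i]. *)
have ephi0 k : u k = \sum_i (c k (phi0 (C1_inr (g i))) : K) *: h i.
  rewrite {1}(dual_basis_coord h_basis g_dual (u k)); apply: eq_bigr => i _.
  congr (_ *: _); rewrite [u k](tangent_class_coord sqM c1 mc) dual_sumE.
  rewrite /= /classifying /= scale0r add0r linear_sum.
  by apply: eq_bigr => j _; rewrite linearZ; exact: mulrC.
exists phi0; split; first exact/class_eqP.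
move=> phi /class_eqP ephi; apply: (C1_hom_eq h_basis g_dual) => i.
(* Both images lie in M, so they are determined by their [c k] coordinates. These are the
   coefficients of [u k] in the basis [h] for either homomorphism. *)
rewrite [LHS]mc [RHS]mc !aug_inr; congr (_ + _); apply: eq_bigr => k _.
congr (_ *: _).
by apply: (basis_free h_basis (x := fun i => c k (phi0 (C1_inr (g i))))
  (y := fun i => c k (phi (C1_inr (g i))))); rewrite -ephi -ephi0.
Qed.
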